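(* Let $n$ be a positive integer. For each $\lambda\in\mathcal{G_I}(n)$ let $\mathcal{G}_\lambda=\{\varrho_i(\lambda):1\leq i\leq m(\lambda)\}$. Then the sets $\mathcal{G}_\lambda$, $\lambda\in\mathcal{G_I}(n)$, are pairwise disjoint and \[ \mathcal{G}(n)=\bigcup_{\lambda\in\mathcal{G_I}(n)}\mathcal{G}_\lambda . \]
   Context: A partition is a finite multiset of positive integers; $\bar{\ell}(\lambda)$ is its number of distinct part values and $m(\lambda)$ the multiplicity of its largest part. A partition is gap-free if its distinct part values are consecutive integers. $\mathcal{G}(n)$ is the set of gap-free partitions of $n$, and $\mathcal{G_I}(n)$ is the set of gap-free partitions of $n$ with smallest part $1$ and odd largest part. For a gap-free partition $\mu$ with at least $r$ distinct parts, $\xi_r(\mu)$ is obtained by taking the $r$ smallest distinct part values $v$ of $\mu$ and, for each simultaneously, replacing one copy of $v$ by $v+1$. For a gap-free partition $\lambda$ with smallest part $1$, largest part $\ell=\bar{\ell}(\lambda)$ of multiplicity $m(\lambda)$, and $1\leq i\leq m(\lambda)$: let $\lambda^i_1$ be $\lambda$ with $i-1$ copies of its largest part $\ell$ deleted, let $\lambda^i_j=\xi_\ell(\lambda^i_{j-1})$ for $2\leq j\leq i$, and set $\varrho_i(\lambda)=\lambda^i_i$ (at each step the partition to which $\xi_\ell$ is applied is gap-free with at least $\ell$ distinct parts, so this is defined). *)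

(* Defs.v *)
From mathcomp Require Import all_boot finmap multiset.
From mathcomp Require Import classical_sets.

Set Implicit Arguments.
Unset Strict Implicit.
Unset Printing Implicit Defensive.

Local Open Scope mset_scope.

(* For a multiset [lam], [lam v] is the multiplicity of [v], and a big
   operator over [v <- lam] counts [v] with that multiplicity. *)
Definition is_partition_of (n : nat) (lam : {mset nat}) : bool :=
  (0 \notin lam) && (\sum_(v <- lam) v == n).

(* In increasing order, without repetition. *)
Definition part_values (lam : {mset nat}) : seq nat :=
  sort leq (finsupp lam).

(* The default 0 is only reached on the empty partition. *)
Definition smallest_part (lam : {mset nat}) : nat := head 0 (part_values lam).
Definition largest_part (lam : {mset nat}) : nat := last 0 (part_values lam).

Definition num_part_values (lam : {mset nat}) : nat := size (part_values lam).

Definition mult_largest (lam : {mset nat}) : nat := lam (largest_part lam).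

Definition gap_free (lam : {mset nat}) : bool :=
  sorted (fun u v => v == u.+1) (part_values lam).

Definition gap_free_partitions (n : nat) : set {mset nat} :=
  [set lam | is_partition_of n lam /\ gap_free lam]%classic.

Definition gap_free_partitions_I (n : nat) : set {mset nat} :=
  [set lam | [/\ gap_free_partitions n lam, smallest_part lam = 1
               & odd (largest_part lam)]]%classic.

(* Meaningful when [mu] has at least [r] distinct part values; otherwise
   all of them are used. *)
Definition xi (r : nat) (mu : {mset nat}) : {mset nat} :=
  let vs := take r (part_values mu) in
  (mu `\` seq_mset vs) `+` seq_mset [seq v.+1 | v <- vs].

(* Only used for [1 <= i <= mult_largest lam]. *)
Definition varrho (i : nat) (lam : {mset nat}) : {mset nat} :=
  iter i.-1 (xi (num_part_values lam))
    (lam `\` msetn i.-1 (largest_part lam)).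

Definition varrho_family (lam : {mset nat}) : set {mset nat} :=
  [set varrho i lam | i in [set i | 1 <= i <= mult_largest lam]]%classic.

(* Main.v *)
Require Import Defs.
From mathcomp Require Import all_boot finmap multiset.
From mathcomp Require Import classical_sets.
From mathcomp Require Import zify.

Set Implicit Arguments.
Unset Strict Implicit.
Unset Printing Implicit Defensive.

Local Open Scope mset_scope.

(** On a gap-free partition with [l] or [l.+1] distinct parts, [xi l] merely
    replaces one copy of the smallest part [a] by [a + l], and the result again
    has [l] or [l.+1] distinct parts, with largest part [a + l].  So [xi l] is
    injective on such partitions, and its image consists of those whose largest
    part exceeds [l]; undoing it as long as possible ends at a partition with
    parts exactly [1..l].  Adding back one copy of [l] per undone step recovers
    the weight.  Since [l] is odd, it is determined by the parity of the number
    of distinct parts. *)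

Lemma mem_part_values (mu : {mset nat}) (v : nat) :
  (v \in part_values mu) = (0 < mu v).
Proof. by rewrite mem_sort msuppE in_mset. Qed.

(** Trades equalities of sorted lists for pointwise conditions on multiplicities, which arithmetic
    settles value by value. *)
Lemma part_values_iotaP (mu : {mset nat}) (a k : nat) :
  part_values mu = iota a k <-> forall v, (0 < mu v) = (a <= v < a + k).
Proof.
split=> [E v|E]; first by rewrite -mem_part_values E mem_iota.
apply: (sorted_eq leq_trans anti_leq).
- exact: sort_sorted leq_total _.
- exact: iota_sorted.
- apply: uniq_perm; [by rewrite sort_uniq fset_uniq | exact: iota_uniq |].
  by move=> v; rewrite mem_part_values E mem_iota.
Qed.

Lemma sorted_succP (s : seq nat) :
  reflect (s = iota (head 0 s) (size s)) (sorted (fun u v => v == u.+1) s).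
Proof.
apply: (iffP idP) => [|->]; last first.
  elim: (size s) (head 0 s) => //= -[|k] IH a //=.
  by rewrite eqxx; apply: (IH a.+1).
by case: s => //= x s; elim: s x => //= y s IH x /andP[/eqP-> /IH {1}->].
Qed.

Lemma gap_freeP (mu : {mset nat}) :
  gap_free mu <-> exists a k, part_values mu = iota a k.
Proof.
split=> [/sorted_succP E|[a [k E]]]; first by eexists; eexists; exact: E.
by rewrite /gap_free E; apply/sorted_succP; case: k {E} => //= k; rewrite size_iota.
Qed.

Lemma sum_msetD (A B : {mset nat}) :
  \sum_(v <- A `+` B) v = \sum_(v <- A) v + \sum_(v <- B) v.
Proof.
rewrite -big_cat; apply: perm_big; apply/allP => v _ /=.
by rewrite count_cat !count_mem_mset msetE2.
Qed.

Lemma sum_msetn (j a : nat) : \sum_(v <- msetn j a) v = j * a.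
Proof. by rewrite enum_msetn big_nseq iter_addn_0 mulnC. Qed.

(** The step removes [a, ..., a + l - 1] and adds [a + 1, ..., a + l], so all but the two ends
    cancel. *)
Lemma xi_step (l a k : nat) (mu : {mset nat}) : l <= k ->
  part_values mu = iota a k -> 0 < l -> xi l mu = (a + l) +` (mu `\ a).
Proof.
move=> lk E l0; have /part_values_iotaP M := E.
apply/msetP => v; rewrite /xi E take_iota (minn_idPl lk).
rewrite (eq_map (g := addn 1)) // -iotaDl.
rewrite !msetE2 !msetnE !mset_seqE !count_uniq_mem ?iota_uniq // !mem_iota.
move: (M v); case: eqP; case: eqP; lia.
Qed.

Definition window (l a : nat) (mu : {mset nat}) : Prop :=
  0 < a /\ exists2 k, l <= k <= l.+1 & part_values mu = iota a k.

Section Window.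

Variables (l : nat) (l_gt0 : 0 < l).

Lemma window_xi (a : nat) (mu : {mset nat}) : window l a mu ->
  xi l mu = (a + l) +` (mu `\ a).
Proof. by case=> _ [k /andP[lk _] E]; exact: xi_step E _. Qed.

Lemma window_mem (a : nat) (mu : {mset nat}) : window l a mu -> 0 < mu a.
Proof. by case=> _ [k lk /part_values_iotaP ->]; lia. Qed.

Lemma window_step (a : nat) (mu : {mset nat}) : window l a mu ->
  exists a', window l a' (xi l mu).
Proof.
move=> W; rewrite (window_xi W); have m0 := window_mem W.
case: W => a0 [k lk /part_values_iotaP M].
(* The largest part is now [a + l]; the smallest moves up to [a.+1] exactly when the only copy of
   [a] was used, leaving [l] values instead of [l.+1]. *)
exists (a + (mu a == 1)); split; first lia.
exists (l + (mu a != 1)); first lia.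
apply/part_values_iotaP => v; rewrite mset1DE msetB1E; move: (M v).
by case: (v =P a) => [->|?]; case: eqP; lia.
Qed.

Lemma window_iter (j a : nat) (mu : {mset nat}) : window l a mu ->
  exists a', window l a' (iter j (xi l) mu).
Proof. by move=> W; elim: j => [|j [b /window_step//]]; exists a. Qed.

Lemma sum_xi (a : nat) (mu : {mset nat}) : window l a mu ->
  \sum_(v <- xi l mu) v = \sum_(v <- mu) v + l.
Proof.
move=> W; rewrite (window_xi W); have := window_mem W; rewrite mset_gt0.
move=> /msetB1K {2}<-; rewrite !sum_msetD !sum_msetn; lia.
Qed.

Lemma sum_iter_xi (j a : nat) (mu : {mset nat}) : window l a mu ->
  \sum_(v <- iter j (xi l) mu) v = \sum_(v <- mu) v + j * l.
Proof.
move=> W; elim: j => [|j IH] /=; first by rewrite addn0.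
by have [b /sum_xi->] := window_iter j W; rewrite IH mulSn addnAC addnA.
Qed.

Lemma xi_gt (a v : nat) (mu : {mset nat}) : window l a mu ->
  0 < xi l mu v -> v <= a + l.
Proof.
move=> W; rewrite (window_xi W) mset1DE msetB1E.
by case: W => _ [k lk /part_values_iotaP M]; have := M v; case: eqP; lia.
Qed.

Lemma xi_top (a : nat) (mu : {mset nat}) : window l a mu -> 0 < xi l mu (a + l).
Proof. by move=> /window_xi->; rewrite mset1DE eqxx. Qed.

Lemma xi_inj (a b : nat) (mu nu : {mset nat}) :
  window l a mu -> window l b nu -> xi l mu = xi l nu -> mu = nu.
Proof.
move=> Wm Wn E.
(* Both [a + l] and [b + l] are the largest part of the common image. *)
have ab : a = b.
  have := xi_top Wn; rewrite -E => /(xi_gt Wm).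
  have := xi_top Wm; rewrite E => /(xi_gt Wn).
  by lia.
have := window_mem Wm; have := window_mem Wn; move: E.
rewrite (window_xi Wm) (window_xi Wn) -ab !mset_gt0.
move=> /(congr1 (fun A => A `\ (a + l))); rewrite !msetD1K => E.
by move=> /msetB1K <- /msetB1K <-; rewrite E.
Qed.

Lemma iter_xi_inj (j a b : nat) (mu nu : {mset nat}) :
  window l a mu -> window l b nu ->
  iter j (xi l) mu = iter j (xi l) nu -> mu = nu.
Proof.
move=> Wm Wn; elim: j => //= j IH; have [c Wc] := window_iter j Wm.
by have [d Wd] := window_iter j Wn; move=> /(xi_inj Wc Wd).
Qed.

Lemma window_unstep (a v : nat) (mu : {mset nat}) : window l a mu ->
  l < v -> 0 < mu v -> exists b nu, window l b nu /\ xi l nu = mu.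
Proof.
case=> a0 [k lk /part_values_iotaP M] lv v0.
have {v lv v0} top : l < a + k.-1 by have := M v; lia.
(* The largest part [b + l] of [mu] is lowered by [l]. Here [b] is [a.-1] if [k = l] and [a] if
   [k = l.+1]; [top] makes it positive. *)
pose b := a + k.-1 - l; pose nu := b +` (mu `\ (b + l)).
have mb : 0 < mu (b + l) by rewrite M /b; lia.
have W : window l b nu.
  split; first by rewrite /b; lia.
  exists (l + (mu (b + l) != 1)); first lia.
  apply/part_values_iotaP => v; rewrite mset1DE msetB1E; move: (M v) (M b).
  case: (v =P b + l) => [->|?]; case: eqP; rewrite /b in mb *; lia.
exists b, nu; split=> //; rewrite (window_xi W) msetD1K.
by apply: msetB1K; rewrite -mset_gt0.
Qed.

Lemma window_unwind (a : nat) (mu : {mset nat}) : window l a mu ->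
  exists j nu, part_values nu = iota 1 l /\ mu = iter j (xi l) nu.
Proof.
(* Induction on the weight, which drops by [l] with each undone step. *)
have [N] := ubnP (\sum_(v <- mu) v).
elim: N a mu => // N IH a mu muN W; have [a0 [k lk E]] := W.
have /part_values_iotaP M := E.
(* As [a >= 1] and [k >= l], this bound forces [a = 1] and [k = l]. *)
have [top|top] := leqP (a + k) l.+1.
  by exists 0, mu; split=> //=; rewrite E; congr iota; lia.
have [||b [nu [Wn def_mu]]] := @window_unstep a (a + k.-1) mu W.
- lia.
- by rewrite M; lia.
have [|j [ka [E' def_nu]]] := IH b nu _ Wn.
  by move: muN; rewrite -def_mu (sum_xi Wn); lia.
by exists j.+1, ka; rewrite /= -def_nu.
Qed.

Lemma window1 (nu : {mset nat}) : part_values nu = iota 1 l -> window l 1 nu.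
Proof. by move=> E; split=> //; exists l; rewrite ?leqnn ?leqnSn. Qed.

(* If [j < j'], cancelling [j] steps would make [mu] an image of [xi l],
   so its largest part would exceed [l]. *)
Lemma iter_xi_eq_leq (j j' : nat) (mu nu : {mset nat}) :
  part_values mu = iota 1 l -> part_values nu = iota 1 l ->
  iter j (xi l) mu = iter j' (xi l) nu -> j' <= j.
Proof.
move=> Em En E; rewrite leqNgt; apply/negP => jj'; move: E.
rewrite -(subnKC jj') addSnnS iterD => E.
have [c Wc] := window_iter (j' - j.+1) (window1 En).
have [d Wd] := window_step Wc.
have def_mu := iter_xi_inj (window1 Em) Wd E.
have := xi_top Wc; rewrite -def_mu.
by have /part_values_iotaP -> := Em; case: Wc; lia.
Qed.

End Window.

Lemma gap_free_IP (n : nat) (lam : {mset nat}) :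
  gap_free_partitions_I n lam ->
  [/\ part_values lam = iota 1 (largest_part lam),
      num_part_values lam = largest_part lam, odd (largest_part lam)
    & \sum_(v <- lam) v = n].
Proof.
move=> [[/andP[_ /eqP sn] /gap_freeP[a [k E]]]].
rewrite /smallest_part /largest_part /num_part_values E size_iota.
(* If [k = 0], the smallest part would be the default 0, not 1. *)
by case: k {E} => //= k ->; rewrite -nth_last size_iota; case: k => // k; rewrite nth_iota.
Qed.

(** Since [i] is at most the multiplicity of [l], a copy of [l] survives the deletion, so [nu] keeps
    all the values [1..l]. *)
Lemma varrhoE (n i : nat) (lam : {mset nat}) :
  gap_free_partitions_I n lam -> 1 <= i <= mult_largest lam ->
  exists l nu, [/\ odd l, part_values nu = iota 1 l, lam = nu `+` msetn i.-1 l,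
     varrho i lam = iter i.-1 (xi l) nu & \sum_(v <- varrho i lam) v = n].
Proof.
move=> /gap_free_IP[E nE odd_l sn] im; have l0 := odd_gt0 odd_l.
rewrite /varrho nE; rewrite /mult_largest in im.
move: (largest_part lam) => l in E nE odd_l im l0 *.
have /part_values_iotaP M := E.
set nu := lam `\` _.
have En : part_values nu = iota 1 l.
  apply/part_values_iotaP => v; rewrite msetE2 msetnE -M.
  by case: eqP => [->|?]; lia.
have def_lam : lam = nu `+` msetn i.-1 l.
  apply/msetP => v; rewrite !msetE2 msetnE; case: eqP => [->|?]; lia.
exists l, nu; split=> //.
by rewrite (sum_iter_xi l0 _ (window1 En)) -sn def_lam sum_msetD sum_msetn.
Qed.

(** Both are the largest odd number not exceeding the number of distinct parts. *)
Lemma window_odd_eq (l l' a b : nat) (mu : {mset nat}) : odd l -> odd l' ->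
  window l a mu -> window l' b mu -> l = l'.
Proof.
move=> ol ol' [_ [k lk E]] [_ [k' lk' E']].
have : k = k' by rewrite -(size_iota a k) -E E' size_iota.
by lia.
Qed.

Theorem theorem5p3 (n : nat) (hn : 0 < n) :
  trivIset (gap_free_partitions_I n) varrho_family /\
  gap_free_partitions n =
    (\bigcup_(lam in gap_free_partitions_I n) varrho_family lam)%classic.
Proof.
split.
  move=> lam lam' G G' [mu [[i im <-] [i' im']]].
  have [l [nu [ol Em -> -> _]]] := varrhoE G im.
  have [l' [nu' [ol' Em' -> -> _]]] := varrhoE G' im' => E.
  have [a Wa] := window_iter (odd_gt0 ol) i.-1 (window1 Em).
  have [b Wb] := window_iter (odd_gt0 ol') i'.-1 (window1 Em').
  rewrite E in Wb; have ll' := window_odd_eq ol ol' Wa Wb; subst l'.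
  have l0 := odd_gt0 ol.
  have ii' : i.-1 = i'.-1.
    by apply/anti_leq; rewrite !(iter_xi_eq_leq l0 _ _ E, iter_xi_eq_leq l0 _ _ (esym E)).
  rewrite -ii' in E *.
  by rewrite (iter_xi_inj l0 (window1 Em') (window1 Em) E).
apply/seteqP; split=> mu.
  move=> [/andP[mu0 /eqP sn] /gap_freeP[a [k E]]].
  (* The empty partition has weight 0, contrary to [hn]. *)
  have k0 : 0 < k.
    rewrite lt0n; apply/eqP => k0; move: hn; rewrite -sn sum_mset.
    rewrite big1_seq // => v /=; rewrite msuppE in_mset -mem_part_values.
    by rewrite E k0.
  have a0 : 0 < a.
    rewrite lt0n; apply/eqP => a0; move: mu0.
    by rewrite in_mset -mem_part_values E a0 mem_iota; lia.
  pose l := k - ~~ odd k; have ol : odd l by rewrite /l; lia.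
  have l0 := odd_gt0 ol.
  have W : window l a mu by split=> //; exists k => //; rewrite /l; lia.
  have [j [nu [En def_mu]]] := window_unwind l0 W.
  have /part_values_iotaP M := En.
  (* Each of the [j] undone steps lowered the weight by [l]; the added copies of [l] restore it. *)
  pose lam := nu `+` msetn j l.
  have El : part_values lam = iota 1 l.
    apply/part_values_iotaP => v; rewrite msetE2 msetnE addn_gt0 M.
    by case: eqP => [->|?]; lia.
  have Ll : largest_part lam = l.
    rewrite /largest_part El -nth_last size_iota nth_iota; lia.
  exists lam.
    split; [split; [apply/andP; split|] | | by rewrite Ll].
    - by rewrite in_mset -mem_part_values El mem_iota.
    - by rewrite sum_msetD sum_msetn -(sum_iter_xi l0 _ (window1 En)) -def_mu sn.
    - by apply/gap_freeP; exists 1, l.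
    - by rewrite /smallest_part El -(prednK l0).
  (* This index is admissible because [nu] already contains a copy of [l]. *)
  exists j.+1.
    by rewrite /= /mult_largest Ll msetE2 msetnxx; have := M l; lia.
  rewrite /varrho /num_part_values Ll El size_iota def_mu /=; congr iter.
  by apply/msetP => v; rewrite !msetE2 addnK.
move=> [lam G [i im <-]].
have [l [nu [ol En _ E sn]]] := varrhoE G im.
have [a [a0 [k lk Ek]]] := window_iter (odd_gt0 ol) i.-1 (window1 En).
rewrite -E in Ek; split; last by apply/gap_freeP; exists a, k.
rewrite /is_partition_of sn eqxx andbT in_mset -mem_part_values Ek mem_iota.
by lia.
Qed.
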